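(* Let $\alpha=\omega\nu$ with $\nu\ge1$ an ordinal. The covering dimension of the topological space $R_\alpha|_{[0,1]}$ in the order topology equals $1$: $\dim R_\alpha|_{[0,1]}=1$.
   Context: For an ordinal $\alpha=\omega\nu$, $\nu\ge1$ (a nonzero limit ordinal), let $A_\alpha$ be the set of all transfinite sequences $X_{(0,\alpha)}=(X_{\alpha'})_{0\le\alpha'<\alpha}$ with $X_{\alpha'}\in\{0,1\}$, ordered lexicographically: $X_{(0,\alpha)}<Y_{(0,\alpha)}$ iff there is $\alpha'<\alpha$ with $X_{\alpha'}=0$, $Y_{\alpha'}=1$ and $X_\beta=Y_\beta$ for all $\beta<\alpha'$. Such a pair is called a pair of twins if in addition $X_\beta=1$ and $Y_\beta=0$ for all $\beta$ with $\alpha'<\beta<\alpha$. $R_\alpha|_{[0,1]}$ is the quotient set $A_\alpha/{\sim}$, where $\sim$ identifies the two members of each pair of twins, with the induced linear order. $\dim$ denotes Lebesgue covering dimension. *)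

(* Defs.v *)
From HB Require Import structures.
From Stdlib Require Import Relation_Operators.
From mathcomp Require Import all_boot all_order.
From mathcomp Require Import all_classical.
From mathcomp Require Import topology.

Set Implicit Arguments.
Unset Strict Implicit.
Unset Printing Implicit Defensive.

Import Order.TTheory.
Local Open Scope order_scope.
Local Open Scope classical_set_scope.
Local Open Scope quotient_scope.
Local Open Scope card_scope.

(** Ordinals are represented by well-ordered types, up to order isomorphism:
    the ordinals below [alpha] are the elements of the type [alpha]. *)

HB.mixin Record isWellOrder d T & Order.Total d T := {
  le_well_order : wochoice.well_order (<=%O : rel T)
}.

#[short(type="wellOrderType")]
HB.structure Definition WellOrder d := { T of Order.Total d T & isWellOrder d T }.

Definition order_isomorphic d1 d2 (S : porderType d1) (T : porderType d2) :=
  exists f : S -> T, bijective f /\ {mono f : x y / x <= y}.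

(** [omega * nu] is [nu] consecutive copies of [omega], so the index in [nu] is
    the more significant component. *)
Definition omega_mul d (nu : wellOrderType d) := (nu *l nat)%type.

Lemma ex_least d (T : wellOrderType d) (P : T -> Prop) :
  (exists x, P x) -> exists x, P x /\ forall y, y < x -> ~ P y.
Proof.
case=> x Px; pose A : {pred T} := fun y => `[<P y>].
have /(@le_well_order d T A)[z [[/asboolP Pz zmin] _]] : wochoice.nonempty A.
  by exists x; exact/asboolP.
exists z; split=> // y yz Py; have : z <= y by apply: zmin; exact/asboolP.
by rewrite leNgt yz.
Qed.

Definition binseq d (alpha : wellOrderType d) : Type := alpha -> bool.

HB.instance Definition _ d (alpha : wellOrderType d) :=
  Choice.copy (binseq alpha) (alpha -> bool).

Section Lexicographic.
Context d (alpha : wellOrderType d).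
Implicit Types X Y Z : binseq alpha.

Definition lex_lt X Y : Prop := exists a : alpha,
  [/\ X a = false, Y a = true & forall b, b < a -> X b = Y b].

Definition lex_ltb X Y : bool := `[<lex_lt X Y>].
Definition lex_leb X Y : bool := (X == Y) || lex_ltb X Y.

Lemma lex_irr : irreflexive lex_ltb.
Proof. by move=> X; apply/negP => /asboolP[a [->]]. Qed.

Lemma lex_trans : transitive lex_ltb.
Proof.
move=> Y X Z /asboolP[a [Xa Ya XY]] /asboolP[b [Yb Zb YZ]]; apply/asboolP.
have [ab|ba|E] := ltgtP a b.
- exists a; split=> //; first by rewrite -YZ.
  by move=> c ca; rewrite XY// YZ// (lt_trans ca ab).
- exists b; split=> //; first by rewrite XY.
  by move=> c cb; rewrite XY ?YZ// (lt_trans cb ba).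
- by move: Yb; rewrite -E Ya.
Qed.

Lemma lex_total X Y : X != Y -> lex_ltb X Y || lex_ltb Y X.
Proof.
move=> /eqP XY.
have [|a [nXY agree]] := @ex_least d alpha (fun b => X b <> Y b).
  apply: contrapT => nE; apply: XY; apply/funext => b.
  by apply: contrapT => nb; apply: nE; exists b.
have {}agree b : b < a -> X b = Y b by move=> /agree /contrapT.
case Xa : (X a); case Ya : (Y a); rewrite ?Xa ?Ya // in nXY.
- apply/orP; right; apply/asboolP; exists a; split=> // b /agree ->//.
- by apply/orP; left; apply/asboolP; exists a.
Qed.

Lemma lex_lt_def X Y : lex_ltb X Y = (Y != X) && lex_leb X Y.
Proof.
rewrite /lex_leb; have [->|] := eqVneq X Y; first by rewrite lex_irr.
by [].
Qed.

Lemma lex_refl : reflexive lex_leb.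
Proof. by move=> X; rewrite /lex_leb eqxx. Qed.

Lemma lex_anti : antisymmetric lex_leb.
Proof.
move=> X Y; rewrite /lex_leb eq_sym; have [->//|_/=] := eqVneq Y X.
by move=> /andP[XY YX]; have := lex_trans XY YX; rewrite lex_irr.
Qed.

Lemma lex_le_trans : transitive lex_leb.
Proof.
move=> Y X Z; rewrite /lex_leb => /orP[/eqP->//|XY] /orP[/eqP<-|YZ].
  by rewrite XY orbT.
by rewrite (lex_trans XY YZ) orbT.
Qed.

HB.instance Definition _ := Order.isPOrder.Build d (binseq alpha)
  lex_lt_def lex_refl lex_anti lex_le_trans.

Lemma lex_le_total : total lex_leb.
Proof.
move=> X Y; rewrite /lex_leb; have [->|/lex_total/orP[]->] := eqVneq X Y;
  by rewrite ?eqxx ?orbT.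
Qed.

HB.instance Definition _ :=
  Order.POrder_isTotal.Build d (binseq alpha) lex_le_total.

End Lexicographic.

Section Quotient.
Context d (alpha : wellOrderType d).
Implicit Types X Y Z : binseq alpha.

Definition twins X Y : Prop := exists a : alpha,
  [/\ X a = false, Y a = true, forall b, b < a -> X b = Y b &
      forall b, a < b -> X b = true /\ Y b = false].

(** When [alpha] is a limit ordinal, a sequence has at most one twin and this
    closure only adds the reflexive and symmetric pairs. *)
Definition same_real X Y : Prop := clos_refl_sym_trans _ twins X Y.

Definition same_realb X Y : bool := `[<same_real X Y>].

Lemma same_realb_refl : reflexive same_realb.
Proof. by move=> X; apply/asboolP; exact: rst_refl. Qed.

Lemma same_realb_sym : symmetric same_realb.
Proof. by move=> X Y; apply/asboolP/asboolP => ?; exact: rst_sym. Qed.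

Lemma same_realb_trans : transitive same_realb.
Proof.
move=> Y X Z /asboolP XY /asboolP YZ; apply/asboolP.
by apply: rst_trans YZ.
Qed.

Canonical same_real_equiv :=
  EquivRel same_realb same_realb_refl same_realb_sym same_realb_trans.

Definition R01 : Type := {eq_quot same_realb}.

HB.instance Definition _ := Choice.on R01.
HB.instance Definition _ := EqQuotient.on R01.

(** The class of [X] lies below that of [Y] when some representatives do. *)
Definition R01_le (u v : R01) : Prop := exists X Y : binseq alpha,
  [/\ \pi_R01 X = u, \pi_R01 Y = v & X <= Y].

Definition R01_leb (u v : R01) : bool := `[<R01_le u v>].

Lemma pi_R01E X Y : \pi_R01 X = \pi_R01 Y <-> same_real X Y.
Proof.
split=> [/eqP|XY]; first by rewrite eqmodE => /asboolP.
by apply/eqP; rewrite eqmodE; apply/asboolP.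
Qed.

Lemma twins_adjacent X Y Z : twins X Y -> X < Z -> Y <= Z.
Proof.
move=> [a [Xa Ya XY tl]] /asboolP[c [Xc Zc XZ]]; rewrite leNgt; apply/negP.
move=> /asboolP[e [Ze Ye ZY]].
have ea : e <= a by rewrite leNgt; apply/negP => /tl[_]; rewrite Ye.
have ca : c <= a by rewrite leNgt; apply/negP => /tl[]; rewrite Xc.
have [ce|ec|E] := ltgtP c e.
- have := ZY _ ce; rewrite Zc -XY ?Xc//; exact: lt_le_trans ce ea.
- have := XZ _ ec; rewrite Ze XY ?Ye//; exact: lt_le_trans ec ca.
- by rewrite E Ze in Zc.
Qed.

Lemma twins_lt X Y : twins X Y -> X < Y.
Proof. by move=> [a [Xa Ya XY _]]; apply/asboolP; exists a. Qed.

Let wle X Y := X <= Y \/ same_real X Y.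

Lemma wle_congl X X' : same_real X X' -> forall Y, wle X Y <-> wle X' Y.
Proof.
elim=> {X X'} [X X' t Y|//|X X' _ IH Y|X X' X'' _ IH _ IH' Y].
- have s : same_real X X' by apply: rst_step.
  split=> -[XY|e]; last 1 first.
  + by right; apply: rst_trans e.
  + move: XY; rewrite le_eqVlt => /orP[/eqP<-|XY].
      by right; apply: rst_sym.
    by left; exact: twins_adjacent XY.
  + by right; apply: rst_trans e; apply: rst_sym.
  + by left; apply: le_trans XY; exact/ltW/twins_lt.
- by rewrite IH.
- by rewrite IH.
Qed.

Lemma wle_congr X X' : same_real X X' -> forall Y, wle Y X <-> wle Y X'.
Proof.
elim=> {X X'} [X X' t Y|//|X X' _ IH Y|X X' X'' _ IH _ IH' Y].
- have s : same_real X X' by apply: rst_step.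
  split=> -[YX|e].
  + by left; apply: le_trans YX _; exact/ltW/twins_lt.
  + by right; apply: rst_trans s.
  + move: YX; rewrite le_eqVlt => /orP[/eqP->|YX].
      by right; apply: rst_sym.
    left; rewrite leNgt; apply/negP => /(twins_adjacent t).
    by rewrite leNgt YX.
  + by right; apply: rst_trans e _; apply: rst_sym.
- by rewrite IH.
- by rewrite IH.
Qed.

Lemma R01_le_pi X Y :
  R01_leb (\pi_R01 X) (\pi_R01 Y) <-> X <= Y \/ same_real X Y.
Proof.
split=> [/asboolP[X' [Y' [/pi_R01E sX /pi_R01E sY le]]]|[le|s]].
- by apply/(wle_congl sX)/(wle_congr sY); left.
- by apply/asboolP; exists X, Y.
- by apply/asboolP; exists X, X; split=> //; exact/pi_R01E.
Qed.

Lemma R01_le_refl : reflexive R01_leb.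
Proof. by move=> u; rewrite -[u]reprK; apply/R01_le_pi; left. Qed.

Lemma R01_le_anti : antisymmetric R01_leb.
Proof.
move=> u v /andP[]; rewrite -[u]reprK -[v]reprK.
move=> /R01_le_pi[uv|s _]; last exact/pi_R01E.
move=> /R01_le_pi[vu|s]; last by apply/pi_R01E/rst_sym.
by congr (\pi_R01 _); apply: le_anti; rewrite uv vu.
Qed.

Lemma R01_le_trans : transitive R01_leb.
Proof.
move=> v u w; rewrite -[u]reprK -[v]reprK -[w]reprK.
move=> /R01_le_pi uv /R01_le_pi vw; apply/R01_le_pi.
case: uv => [uv|s]; last exact/(wle_congl s).
case: vw => [vw|s]; first by left; apply: le_trans vw.
by apply/(wle_congr (rst_sym _ _ _ _ s)); left.
Qed.

Lemma R01_le_total : total R01_leb.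
Proof.
move=> u v; rewrite -[u]reprK -[v]reprK; apply/orP.
by have [|] := leP (repr u) (repr v) => [?|/ltW ?]; [left|right];
  apply/R01_le_pi; left.
Qed.

HB.instance Definition _ := Order.Le_isPOrder.Build d R01
  R01_le_refl R01_le_anti R01_le_trans.
HB.instance Definition _ := Order.POrder_isTotal.Build d R01 R01_le_total.

End Quotient.

Section CoveringDimension.
Variable X : topologicalType.
Implicit Types U V : set (set X).

Definition open_cover U : Prop :=
  (forall A, U A -> open A) /\ \bigcup_(A in U) A = [set: X].

Definition refines V U : Prop :=
  forall B, V B -> exists2 A, U A & B `<=` A.

Definition multiplicity_le V (k : nat) : Prop :=
  forall x : X, [set B | V B /\ B x] #<= `I_k.

Definition finely_covered (k : nat) : Prop :=
  forall U, finite_set U -> open_cover U ->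
  exists V, [/\ finite_set V, open_cover V, refines V U & multiplicity_le V k].

(** [finely_covered n.+1] says that the covering dimension is at most [n]: a
    cover of order at most [n] has multiplicity at most [n + 1].  Stating
    minimality on multiplicities lets [n = 0] exclude the empty space, whose
    dimension is [-1]. *)
Definition covering_dim_is (n : nat) : Prop :=
  finely_covered n.+1 /\ forall k, finely_covered k -> (n < k)%N.

End CoveringDimension.

(* Main.v *)
(* R_alpha|[0,1] is a densely ordered complete chain with endpoints, hence a
   connected space.  Completeness: the supremum of a set of sequences takes at
   [a] the value at [a] of those members whose restriction to [0, a] is
   maximal, and projects to a supremum because classes have at most two
   elements.  Density: as [alpha] has no maximum, between two sequences that
   are not twins there is one that is not a twin of either.  For the upper
   bound, connectedness alone yields finite refinements by open convex sets
   (being able to cover the points up to [x] is a locally constant property of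
   [x]), and a minimal such cover has multiplicity at most 2, since among three
   convex sets with a common point one lies in the union of the other two.  For
   the lower bound, an open refinement of the cover by the complements of the
   two endpoints with disjoint members would disconnect the space. *)
Require Import Defs.
From mathcomp Require Import all_boot all_order interval finmap.
From mathcomp Require Import all_classical topology.

Set Implicit Arguments.
Unset Strict Implicit.
Unset Printing Implicit Defensive.

Import Order.TTheory.
Local Open Scope order_scope.
Local Open Scope classical_set_scope.
Local Open Scope quotient_scope.
Local Open Scope card_scope.

(** * Minimal subfamilies and sets of at most two elements *)

Lemma finite_minimal (I : choiceType) (Q : set (set I)) (V : set I) :
  finite_set V -> Q V ->
  exists W, [/\ W `<=` V, Q W & forall W', W' `<=` W -> Q W' -> W' = W].
Proof.
have [n] := ubnP #|` fset_set V|; elim: n V => // n IH V Vn finV QV.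
have [minV|] := pselect (forall W, W `<=` V -> Q W -> W = V).
  by exists V; split.
move=> /existsNP[W /not_implyP[WV /not_implyP[QW neqWV]]].
have finW : finite_set W := sub_finite_set WV finV.
have [|//|//|W' [W'W QW' minW']] := IH W; last first.
  by exists W'; split=> //; exact: subset_trans WV.
suff : (#|` fset_set W| < #|` fset_set V|)%N by move=> /leq_trans; apply.
apply: fproper_ltn_card.
rewrite fproperEneq; apply/andP; split; last by rewrite -fset_set_sub.
by apply: contra_notN neqWV => /eqP e; rewrite -(fset_setK finW) e fset_setK.
Qed.

Lemma card_le2 (I : pointedType) (S : set I) : finite_set S ->
  (forall a b c, S a -> S b -> S c -> a <> b -> a <> c -> b <> c -> False) ->
  S #<= `I_2.
Proof.
move=> /finite_setP[n Sn] no3; rewrite (card_le_eql Sn) card_le_II leqNgt.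
apply/negP => n_gt2; have : `I_3 #<= S by rewrite (card_le_eqr Sn) card_le_II.
move=> /pcard_leP/unsquash f.
have neq i j : (i < 3)%N -> (j < 3)%N -> i <> j -> f i <> f j.
  by move=> i3 j3 ij /inj e; apply: ij; apply: e; rewrite inE.
by apply: (no3 (f 0%N) (f 1%N) (f 2%N)); (exact: funS || exact: neq).
Qed.

(** * Convex sets in a linear order *)

Section OrderConvex.
Context d (T : orderType d).
Implicit Types A B C : set T.

Definition order_convex A :=
  forall x y z, A x -> A z -> x <= y -> y <= z -> A y.

Lemma order_convex_itv (i : interval T) : order_convex [set` i].
Proof.
case: i => l u x y z /=; rewrite !itv_boundlr => /andP[lx _] /andP[_ zu] xy yz.
by rewrite (le_trans lx) ?bnd_simp//= (le_trans _ zu) ?bnd_simp.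
Qed.

(** Otherwise each set has a point outside the other two. Two of these points lie on the same side
    of [x], and by convexity the one nearer to [x] belongs to both of their sets. *)
Lemma order_convex3 A B C x :
  order_convex A -> order_convex B -> order_convex C -> A x -> B x -> C x ->
  [\/ A `<=` B `|` C, B `<=` A `|` C | C `<=` A `|` B].
Proof.
move=> cA cB cC Ax Bx Cx; apply: contrapT => no.
have [a [Aa /not_orP[Ba Ca]]] : A `&` ~` (B `|` C) !=set0.
  by apply: nonsubset => ABC; exact/no/Or31.
have [b [Bb /not_orP[Ab Cb]]] : B `&` ~` (A `|` C) !=set0.
  by apply: nonsubset => BAC; exact/no/Or32.
have [c [Cc /not_orP[Ac Bc]]] : C `&` ~` (A `|` B) !=set0.
  by apply: nonsubset => CAB; exact/no/Or33.
have below D E u v : order_convex D -> order_convex E -> D x -> E x ->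
    D u -> E v -> ~ E u -> ~ D v -> u <= x -> v <= x -> False.
  move=> cD cE Dx Ex Du Ev Eu Dv ux vx; have /orP[uv|vu] := le_total u v.
  - exact: Dv (cD u v x Du Dx uv vx).
  - exact: Eu (cE v u x Ev Ex vu ux).
have above D E u v : order_convex D -> order_convex E -> D x -> E x ->
    D u -> E v -> ~ E u -> ~ D v -> x <= u -> x <= v -> False.
  move=> cD cE Dx Ex Du Ev Eu Dv xu xv; have /orP[uv|vu] := le_total u v.
  - exact: Eu (cE x u v Ex Ev xu uv).
  - exact: Dv (cD x v u Dx Du xv vu).
have /orP[ax|xa] := le_total a x; have /orP[bx|xb] := le_total b x;
  have /orP[cx|xc] := le_total c x.
- exact: (below A B a b).
- exact: (below A B a b).
- exact: (below A C a c).
- exact: (above B C b c).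
- exact: (below B C b c).
- exact: (above A C a c).
- exact: (above A B a b).
- exact: (above A B a b).
Qed.

End OrderConvex.

(** * Connectedness of dense complete orders *)

Lemma connected_locally_constant (X : topologicalType) (P : set X) :
  connected [set: X] -> P !=set0 ->
  (forall x : X, exists2 N : set X,
    nbhs x N & forall y z, N y -> N z -> P y -> P z) ->
  P = setT.
Proof.
move=> cX P0 locP; apply: cX => //; exists P; rewrite ?setTI//.
  rewrite openE => x Px; have [N xN PN] := locP x.
  by apply: filterS (xN) => y Ny; apply: (PN x y) => //; exact: nbhs_singleton.
(* The condition on [N] is symmetric in [y] and [z], so the complement of [P] is open as well. *)
rewrite -openC openE => x Px; have [N xN PN] := locP x.
apply: filterS (xN) => y Ny Py; apply/Px/(PN y x) => //; exact: nbhs_singleton.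
Qed.

Section LinearContinuum.
Context d (T : orderTopologicalType d).

(** The point [x] bounds [l] from below, and serves as [l] when the basic interval around [s] is
    unbounded on the left. *)
Lemma nbhs_order_left (s x : T) (N : set T) : nbhs s N -> x < s ->
  exists2 l, x <= l < s & forall t, l < t <= s -> N t.
Proof.
rewrite itv_nbhsE => -[[l u] [oi /= /andP[ls su]] iN] xs.
have Nt t : (l <= BLeft t)%O -> t <= s -> N t.
  move=> lt ts; apply: iN => /=; rewrite itv_boundlr lt/=.
  by apply: le_trans su; rewrite bnd_simp.
case: l oi ls Nt {iN} => [b l|b] + ls Nt =>
  [/itv_open_ends_lside E|/itv_open_ends_linfty E]; subst b.
  exists (Order.max x l); first by rewrite le_max lexx gt_max xs.
  by move=> t; rewrite gt_max => /andP[/andP[_ lt] ts]; exact: Nt.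
by exists x => [|t /andP[_ ts]]; rewrite ?lexx//; exact: Nt.
Qed.

Lemma nbhs_order_right (s y : T) (N : set T) : nbhs s N -> s < y ->
  exists2 r, s < r <= y & forall t, s <= t < r -> N t.
Proof.
rewrite itv_nbhsE => -[[l u] [oi /= /andP[ls su]] iN] sy.
have Nt t : s <= t -> (BRight t <= u)%O -> N t.
  move=> st tu; apply: iN => /=; rewrite itv_boundlr tu andbT.
  by apply: le_trans ls _; rewrite bnd_simp.
case: u oi su Nt {iN} => [b u|b] + su Nt =>
  [/itv_open_ends_rside E|/itv_open_ends_rinfty E]; subst b.
  exists (Order.min y u); first by rewrite ge_min lexx andbT lt_min sy.
  by move=> t; rewrite lt_min => /andP[st /andP[_ tu]]; exact: Nt.
by exists y => [|t /andP[st _]]; rewrite ?lexx ?andbT//; exact: Nt.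
Qed.

Hypothesis denseT : forall x y : T, x < y -> exists z, x < z < y.
Hypothesis supT : forall S : set T, S !=set0 -> has_ubound S ->
  supremums S !=set0.

Lemma connected_linear_continuum : connected [set: T].
Proof.
(* Applied to the complement of [E], the same claim settles the points below [x]. *)
suff key (E : set T) x y : clopen E -> E x -> x <= y -> E y.
  move=> E [x Ex] [O oO] + [F cF]; rewrite !setTI => EO EF; subst O F.
  apply/seteqP; split=> // y _; have /orP[xy|yx] := le_total x y.
    exact: key xy.
  apply: contrapT => Ey; apply: (key (~` E) y x) => //.
  by split; [rewrite openC|rewrite closedC].
move=> [oE cE] Ex xy; apply: contrapT => nEy.
(* The supremum [s] of [S] lies in [E] because [E] is closed; as [E] is also open, [S] then contains
   points beyond [s]. *)
pose S := [set z | x <= z <= y /\ forall t, x <= t <= z -> E t].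
have Sx : S x.
  by split=> [|t /le_anti <-//]; rewrite lexx.
have [] := @supT S.
- by exists x.
- by exists y => z [/andP[]].
move=> s [ubs lbs].
have xs : x <= s by exact: ubs.
have sy : s <= y by apply: lbs => z [/andP[]].
have Elt t : x <= t -> t < s -> E t.
  move=> xt ts; apply: contrapT => nEt.
  suff : s <= t by rewrite leNgt ts.
  apply: lbs => z [/andP[xz zy] Ez]; rewrite leNgt; apply/negP => tz.
  by apply/nEt/Ez; rewrite xt ltW.
have Es : E s.
  apply: contrapT => nEs.
  have [||l /andP[xl ls] lE] := @nbhs_order_left s x (~` E).
  - by apply: open_nbhs_nbhs; split=> //; rewrite openC.
  - by rewrite lt_neqAle xs andbT; apply: contra_notN nEs => /eqP <-.
  have [t /andP[lt ts]] := denseT ls.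
  apply: (lE t); first by rewrite lt ltW.
  by apply: Elt => //; exact/ltW/(le_lt_trans xl).
have [||r /andP[sr ry] rE] := @nbhs_order_right s y E.
- exact: open_nbhs_nbhs.
- by rewrite lt_neqAle sy andbT; apply: contra_notN nEy => /eqP <-.
have [t /andP[st tr]] := denseT sr.
have : t <= s; last by rewrite leNgt st.
apply: ubs; split=> [|u /andP[xu ut]].
  by rewrite (le_trans xs (ltW st)) (le_trans (ltW tr) ry).
have [su|us] := leP s u; last exact: Elt.
by apply: rE; rewrite su (le_lt_trans ut).
Qed.

End LinearContinuum.

(** * Covering dimension of a connected order with endpoints *)

Section CoveringDimensionOrder.
Context d (T : orderTopologicalType d).
Hypothesis connT : connected [set: T].
Variables bot top : T.
Hypothesis bot_le : forall x : T, bot <= x.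
Hypothesis le_top : forall x : T, x <= top.

Lemma finite_convex_refinement (U : set (set T)) : open_cover U ->
  exists V, [/\ finite_set V, open_cover V, refines V U &
    forall B, V B -> order_convex B].
Proof.
move=> [oU cU].
pose fine B := [/\ open B, order_convex B & exists2 A, U A & B `<=` A].
have fineP (x : T) : exists2 C, fine C & C x.
  have [A UA Ax] : (\bigcup_(A in U) A) x by rewrite cU.
  have : nbhs x A by apply: open_nbhs_nbhs; split=> //; exact: oU.
  rewrite itv_nbhsE => -[i [oi xi] iA]; exists [set` i] => //; split.
  - exact: itv_open_ends_open.
  - exact: order_convex_itv.
  - by exists A.
pose P := [set x | exists V, [/\ finite_set V, V `<=` fine &
  forall y, y <= x -> (\bigcup_(B in V) B) y]].
have PT : P = setT.
  apply: connected_locally_constant => //.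
    have [C fC Cbot] := fineP bot; exists bot, [set C]; split.
    - exact: finite_set1.
    - by move=> _ ->.
    - move=> y ybot; exists C => //; suff -> : y = bot by [].
      by apply: le_anti; rewrite ybot bot_le.
  move=> x; have [C fC Cx] := fineP x.
  exists C; first by apply: open_nbhs_nbhs; split=> //; case: fC.
  move=> y z Cy Cz [V [finV Vfine coverV]].
  exists (C |` V); split.
  - by rewrite finite_setU; split=> //; exact: finite_set1.
  - by move=> B [->|/Vfine].
  (* Points up to [y] are covered by [V]; those between [y] and [z] lie in [C], which is convex. *)
  - move=> t tz; have [/coverV[B VB Bt]|yt] := leP t y.
      by exists B => //; right.
    exists C; first by left.
    have [_ cC _] := fC; exact: (cC y t z _ _ (ltW yt)).
have [V [finV Vfine coverV]] : P top by rewrite PT.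
exists V; split=> //.
- split; first by move=> B /Vfine[].
  by apply/seteqP; split=> // y _; exact: coverV.
- by move=> B /Vfine[].
- by move=> B /Vfine[].
Qed.

Lemma finely_covered2 : finely_covered T 2.
Proof.
move=> U _ /finite_convex_refinement[V [finV [oV cV] VU convV]].
have [W [WV cW minW]] :=
  @finite_minimal _ [set W | \bigcup_(B in W) B = setT] _ finV cV.
have finW : finite_set W := sub_finite_set WV finV.
(* Removing [A] would leave a smaller cover, against minimality. *)
have irredundant A B C : W A -> W B -> W C -> A <> B -> A <> C ->
    ~ A `<=` B `|` C.
  move=> WA WB WC AB AC ABC.
  suff WE : W `\ A = W by move: WA; rewrite -WE => -[_]; exact.
  apply: minW; first by move=> D [].
  apply/seteqP; split=> // y _.
  have : (\bigcup_(D in W) D) y by rewrite cW.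
  move=> [D WD Dy]; have [DA|DA] := pselect (D = A); last by exists D.
  move: Dy; rewrite DA => /ABC[By|Cy].
  - by exists B => //; split=> // /esym.
  - by exists C => //; split=> // /esym.
exists W; split=> //.
- by split=> // B /WV /oV.
- by move=> B /WV /VU.
move=> x; apply: card_le2; first by apply: sub_finite_set finW => B [].
move=> A B C [WA Ax] [WB Bx] [WC Cx] AB AC BC.
have cW' D : W D -> order_convex D by move=> /WV /convV.
have [||] := order_convex3 (cW' _ WA) (cW' _ WB) (cW' _ WC) Ax Bx Cx.
- exact: irredundant.
- by apply: irredundant => // /esym.
- by apply: irredundant => // /esym.
Qed.

Lemma finely_covered_ge2 k : bot < top -> finely_covered T k -> (1 < k)%N.
Proof.
move=> bot_top fk; rewrite ltnNge; apply/negP => k1.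
have cl1 (x : T) : open (~` [set x]).
  by rewrite openC -set_itv1; exact: itv_closed.
have [||V [finV [oV cV] VU multV]] := fk [set ~` [set bot]; ~` [set top]].
- by rewrite finite_setU; split; exact: finite_set1.
- split=> [_ [->|->]//|]; apply/seteqP; split=> // x _.
  have [->|xbot] := eqVneq x bot.
    by exists (~` [set top]); [right|apply/eqP; rewrite lt_eqF].
  by exists (~` [set bot]); [left|exact/eqP].
(* Multiplicity at most 1 makes distinct members disjoint: the injection [f] into [I_1] sends both
   [A] and [B] to 0. *)
have disj A B x : V A -> V B -> A x -> B x -> A = B.
  move=> VA VB Ax Bx; have {k1} : [set C | V C /\ C x] #<= `I_1.
    by apply: card_le_trans (multV x) _; rewrite card_le_II.
  move=> /pcard_leP/unsquash f.
  have f0 C : V C -> C x -> f C = 0%N.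
    move=> VC Cx; have := @funS _ _ _ _ f C (conj VC Cx).
    by rewrite /=; case: (f C).
  apply: (@inj _ _ _ f); [exact: mem_set|exact: mem_set|].
  by rewrite [LHS]f0 ?[RHS]f0.
have [A VA Abot] : (\bigcup_(B in V) B) bot by rewrite cV.
(* A member meeting [A] equals [A], so membership in [A] is constant on each member of the cover. *)
have AT : A = setT.
  apply: connected_locally_constant => //; first by exists bot.
  move=> x; have [B VB Bx] : (\bigcup_(B in V) B) x by rewrite cV.
  exists B; first by apply: open_nbhs_nbhs; split=> //; exact: oV.
  by move=> y z By Bz Ay; rewrite (disj A B y).
have [_ [->|->]] := VU A VA; rewrite AT.
- by move=> /(_ bot I); exact.
- by move=> /(_ top I); exact.
Qed.

End CoveringDimensionOrder.

(** * Suprema in the lexicographic order *)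

Section Lexicographic.
Context d (alpha : wellOrderType d).
Implicit Types X Y Z : binseq alpha.

(** Here [exceeds a Z Y] says that [Z] is above [Y] with first difference at most [a], so
    [leads Y a] makes [Y] maximal in [S] up to [a]. The supremum [M] copies the leading members,
    with default value 0 where none leads. *)
Lemma binseq_supremum (S : set (binseq alpha)) : supremums S !=set0.
Proof.
pose agree X Y a := forall b : alpha, b < a -> X b = Y b.
pose exceeds a Z Y := exists c : alpha,
  [/\ c <= a, Y c = false, Z c = true & agree Z Y c].
pose leads Y a := S Y /\ forall Z, S Z -> ~ exceeds a Z Y.
pose M : binseq alpha := fun a => `[<exists2 Y, leads Y a & Y a = true>].
have leadsW Y a b : b <= a -> leads Y a -> leads Y b.
  move=> ba [SY lY]; split=> // Z SZ [c [cb Yc Zc ZY]]; apply: (lY Z) => //.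
  by exists c; split=> //; exact: le_trans ba.
have leadsM Y a : leads Y a -> M a = Y a.
  move=> lY; case Ya : (Y a); first by apply/asboolP; exists Y.
  apply/asboolP => -[Z lZ Za]; suff : exceeds a Z Y by apply: lY.2; exact: lZ.1.
  (* At their first difference one of two leading members would exceed the other. *)
  have [|c [ZYc minc]] := @ex_least _ _ (fun b => b <= a /\ Z b <> Y b).
    by exists a; rewrite lexx Za Ya.
  have [ca nZY] := ZYc.
  have agc : agree Z Y c.
    move=> b bc; apply: contrapT => nb; apply: (minc b bc).
    by rewrite (le_trans (ltW bc)).
  exists c; split=> //; case Yc : (Y c) => //; case Zc : (Z c) => //;
    try by rewrite Yc Zc in nZY.
  - case: (lZ.2 Y lY.1); exists c; split=> // b /agc ->//.
  - case: (lZ.2 Y lY.1); exists c; split=> // b /agc ->//.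
exists M; split=> [Y SY|W ubW].
- rewrite leNgt; apply/negP => /asboolP[a [Ma Ya MY]].
  (* If [Y] did not lead at [a], a member exceeding it at the least possible position [c] would lead
     at [c]; then [M c] is 1 while [Y c] is 0, although [c < a]. *)
  suff lY : leads Y a by have := leadsM _ _ lY; rewrite Ma Ya.
  split=> // Z SZ exZ.
  have [|c [[Z' SZ' [ca Yc Zc ZY]] minc]] := @ex_least _ _ (fun c =>
      exists2 Z, S Z & [/\ c <= a, Y c = false, Z c = true & agree Z Y c]).
    by have [c exc] := exZ; exists c, Z.
  have {}ca : c < a.
    by rewrite lt_neqAle ca andbT; apply/eqP => E; rewrite E Ya in Yc.
  suff lZ : leads Z' c by move: (MY _ ca); rewrite (leadsM Z')// Zc Yc.
  split=> // W SW [e [ec Ze We WZ]].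
  have {}ec : e < c.
    by rewrite lt_neqAle ec andbT; apply/eqP => E; rewrite E Zc in Ze.
  apply: (minc e ec); exists W => //; split=> //.
  - exact/ltW/(lt_trans ec).
  - by rewrite -(ZY _ ec).
  - by move=> b be; rewrite WZ// ZY// (lt_trans be).
- rewrite leNgt; apply/negP => /asboolP[a [Wa Ma WM]].
  (* This [Y] agrees with [M] up to [a], hence lies above [W] too. *)
  have /asboolP[Y lY Ya] := Ma.
  have := ubW Y lY.1; rewrite leNgt => /negP; apply; apply/asboolP.
  exists a; split=> // b ba; rewrite WM// (leadsM Y)//.
  exact: leadsW (ltW ba) lY.
Qed.
End Lexicographic.

(** * Twins, density and completeness of the quotient *)

Section NoMaximum.
Context d (alpha : wellOrderType d).
Hypothesis no_max : forall a : alpha, exists b, a < b.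
Implicit Types X Y Z : binseq alpha.

(** Beyond both jumps [Y] would have to be 0 and 1 at once, and [no_max] provides such a
    position. *)
Lemma twins_chain X Y Z : twins X Y -> twins Y Z -> False.
Proof.
move=> [a [_ _ _ Ya]] [b [_ _ _ Yb]].
have [c] := no_max (Order.max a b); rewrite gt_max => /andP[/Ya[_ Yc] /Yb[]].
by rewrite Yc.
Qed.

(** The jump is determined by [X]: it is the last 0 of [X]. *)
Lemma twins_functional X Y Z : twins X Y -> twins X Z -> Y = Z.
Proof.
move=> [a [Xa Ya XY Xa1]] [b [Xb Zb XZ Xb1]].
have E : a = b.
  have [/Xa1[]|/Xb1[]|//] := ltgtP a b; first by rewrite Xb.
  by rewrite Xa.
subst b; apply/funext => c; have [ca|ac|->] := ltgtP c a.
- by rewrite -XY// XZ.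
- by rewrite (Xa1 _ ac).2 (Xb1 _ ac).2.
- by rewrite Ya Zb.
Qed.

(** The jump is the last 1 of [Z]. *)
Lemma twins_injective X Y Z : twins X Z -> twins Y Z -> X = Y.
Proof.
move=> [a [Xa Za XZ Xa1]] [b [Yb Zb YZ Yb1]].
have E : a = b.
  have [/Xa1[]|/Yb1[]|//] := ltgtP a b; first by rewrite Zb.
  by rewrite Za.
subst b; apply/funext => c; have [ca|ac|->] := ltgtP c a.
- by rewrite XZ// YZ.
- by rewrite (Xa1 _ ac).1 (Yb1 _ ac).1.
- by rewrite Xa Yb.
Qed.

(** Two twin steps in opposite directions cancel, and two in the same direction cannot occur. *)
Lemma same_realP X Y : same_real X Y <-> [\/ X = Y, twins X Y | twins Y X].
Proof.
split; last first.
  case=> [->|XY|YX]; first exact: Relation_Operators.rst_refl.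
    exact: Relation_Operators.rst_step.
  exact/Relation_Operators.rst_sym/Relation_Operators.rst_step.
elim=> {X Y} [X Y XY|X|X Y _ [->|XY|YX]|X Y Z _ XY _ YZ].
- exact: Or32.
- exact: Or31.
- exact: Or31.
- exact: Or33.
- exact: Or32.
- case: XY YZ => [->//|XY|YX] [<-|YZ|ZY].
  + exact: Or32.
  + by case: (twins_chain XY YZ).
  + by apply: Or31; exact: twins_injective XY ZY.
  + exact: Or33.
  + by apply: Or31; exact: twins_functional YX YZ.
  + by case: (twins_chain ZY YX).
Qed.

Lemma same_real_lt X Y : X < Y -> same_real X Y -> twins X Y.
Proof.
move=> XY /same_realP[E|//|/twins_lt]; first by rewrite E ltxx in XY.
by move=> /(lt_trans XY); rewrite ltxx.
Qed.

Lemma pi_lt X Y : (\pi_(R01 alpha) X < \pi_(R01 alpha) Y) <->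
  X < Y /\ ~ twins X Y.
Proof.
have -> : (\pi_(R01 alpha) X < \pi_(R01 alpha) Y)%O =
    ~~ (R01_leb (\pi_(R01 alpha) Y) (\pi_(R01 alpha) X)) by rewrite ltNge.
split=> [/negP nYX|[XY nXY]].
  split.
    by rewrite ltNge; apply: contra_notN nYX => ?; apply/R01_le_pi; left.
  by move=> XY; apply/nYX/R01_le_pi; right; apply/same_realP/Or33.
apply/negP => /R01_le_pi[|]; first by rewrite leNgt XY.
by move=> YX; apply/nXY/same_real_lt => //; exact: Relation_Operators.rst_sym.
Qed.

Lemma pi_le X Y : X <= Y -> (\pi_(R01 alpha) X <= \pi_(R01 alpha) Y).
Proof. by move=> XY; apply/R01_le_pi; left. Qed.

(** Twins would jump at their first difference [a], which the values at [b] rule out. *)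
Lemma pi_lt_first_diff X Y (a b : alpha) : X a = false -> Y a = true ->
    (forall c, c < a -> X c = Y c) -> a < b -> X b = false \/ Y b = true ->
  (\pi_(R01 alpha) X < \pi_(R01 alpha) Y)%O.
Proof.
move=> Xa Ya XY ab XYb; apply/pi_lt; split; first by apply/asboolP; exists a.
move=> [e [Xe Ye XYe tl]].
have E : e = a.
  have [/XY|/XYe|//] := ltgtP e a; first by rewrite Xe Ye.
  by rewrite Xa Ya.
by move: (tl b); rewrite E => /(_ ab)[Xb Yb]; case: XYb; rewrite ?Xb ?Yb.
Qed.

Lemma R01_dense (u v : R01 alpha) : u < v -> exists w, u < w < v.
Proof.
rewrite -[u]reprK -[v]reprK => /pi_lt[].
move: (repr u) (repr v) => X Y {u v} /asboolP[a [Xa Ya XY]] nXY.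
have [b ab XYb] : exists2 b, a < b & X b = false \/ Y b = true.
  apply: contrapT => /forall2NP nb; apply: nXY; exists a; split=> // b ab.
  by case: (nb b) => // /not_orP[]; case: (X b); case: (Y b).
have [c bc] := no_max b.
have [e ce] := no_max c.
have be := lt_trans bc ce.
(* [flip Z] leaves [Z] at [b], where it takes the value [~~ Z b], and then has
   both a 1 (at [c]) and a 0 (at [e]), so it is not a twin of its neighbours. *)
pose flip Z : binseq alpha :=
  fun x => if x < b then Z x else if x == b then ~~ Z b else x == c.
have flip_lt Z x : x < b -> flip Z x = Z x by rewrite /flip => ->.
have flip_b Z : flip Z b = ~~ Z b by rewrite /flip ltxx eqxx.
have flip_gt Z x : b < x -> flip Z x = (x == c).
  by move=> bx; rewrite /flip (lt_gtF bx) (gt_eqF bx).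
have flip_c Z : flip Z c = true by rewrite flip_gt// eqxx.
have flip_e Z : flip Z e = false by rewrite flip_gt// gt_eqF.
(* Raising a 0 of [X] at [b], or lowering a 1 of [Y] there, leaves the first difference from the
   other sequence at [a]. *)
case: XYb => [Xb|Yb].
  exists (\pi_(R01 alpha) (flip X)); apply/andP; split.
    apply: (@pi_lt_first_diff _ _ b c) => //; first by rewrite flip_b Xb.
      by move=> x /flip_lt ->.
    by right.
  apply: (@pi_lt_first_diff _ _ a e) => //; first by rewrite flip_lt.
  - by move=> x xa; rewrite flip_lt ?XY// (lt_trans xa ab).
  - exact: lt_trans ab be.
  - by left.
exists (\pi_(R01 alpha) (flip Y)); apply/andP; split.
  apply: (@pi_lt_first_diff _ _ a c) => //; first by rewrite flip_lt.
  - by move=> x xa; rewrite flip_lt ?XY// (lt_trans xa ab).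
  - exact: lt_trans ab bc.
  - by right.
apply: (@pi_lt_first_diff _ _ b e) => //; first by rewrite flip_b Yb.
  by move=> x /flip_lt ->.
by left.
Qed.

(** Let [X] be the supremum of the preimage of [S]. If the class of some [W] were a smaller upper
    bound, every member of the preimage above [W] would be its twin; but two such members exist, and
    a sequence has only one upper twin. *)
Lemma R01_supremum (S : set (R01 alpha)) : supremums S !=set0.
Proof.
have [X [ubX lubX]] := binseq_supremum [set X | S (\pi_(R01 alpha) X)].
exists (\pi_(R01 alpha) X); split=> [u Su|v ubv].
  by rewrite -[u]reprK; apply/pi_le/ubX; rewrite /= reprK.
rewrite leNgt; apply/negP; move: ubv; rewrite -[v]reprK.
move: (repr v) => W {v} ubW /pi_lt[WX nWX].
have above Y : Y < X -> exists2 Z, S (\pi_(R01 alpha) Z) & Y < Z.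
  move=> YX; apply: contrapT => /forall2NP nZ.
  move: YX; rewrite ltNge => /negP; apply; apply: lubX => Z SZ.
  by have [//|/negP] := nZ Z; rewrite -leNgt.
have same Z : S (\pi_(R01 alpha) Z) -> W < Z -> twins W Z.
  move=> SZ WZ; apply: contrapT => nWZ.
  by have /pi_lt := conj WZ nWZ; rewrite ltNge ubW.
have [Y SY WY] := above W WX; have tWY := same _ SY WY.
(* [Y] is a twin of [W] and [X] is not, so there is room for a second member [Z] above [Y]. *)
have YX : Y < X.
  by rewrite lt_neqAle ubX// andbT; apply: contra_notN nWX => /eqP <-.
have [Z SZ YZ] := above Y YX; have tWZ := same _ SZ (lt_trans WY YZ).
by move: YZ; rewrite (twins_functional tWY tWZ) ltxx.
Qed.

End NoMaximum.

(** * Limit ordinals, endpoints and the dimension *)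

Lemma omega_mul_no_max d (nu : wellOrderType d) (x : omega_mul nu) :
  exists y, x < y.
Proof.
case: x => n k; exists (n, k.+1).
by rewrite ltxi_pair lexx /= ltEnat /=.
Qed.

Lemma order_isomorphic_no_max d1 d2 (S : orderType d1) (T : porderType d2) :
  order_isomorphic S T -> (forall y : T, exists z, y < z) ->
  forall x : S, exists z, x < z.
Proof.
move=> [f [[g gK fK] /leW_mono f_lt]] noT x; have [z fxz] := noT (f x).
by exists (g z); rewrite -f_lt fK.
Qed.

Section Endpoints.
Context d (alpha : wellOrderType d).

Lemma binseq_ge0 (X : binseq alpha) : ((fun=> false) : binseq alpha) <= X.
Proof. by rewrite leNgt; apply/negP => /asboolP[a []]. Qed.

Lemma binseq_le1 (X : binseq alpha) : X <= ((fun=> true) : binseq alpha).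
Proof. by rewrite leNgt; apply/negP => /asboolP[a []]. Qed.

End Endpoints.

Theorem theorem6 (d d' : Order.disp_t)
    (nu : wellOrderType d) (alpha : wellOrderType d')
    (nu_ge1 : inhabited nu)
    (alphaE : order_isomorphic alpha (omega_mul nu)) :
  covering_dim_is (order_topology (R01 alpha)) 1.
Proof.
have no_max := order_isomorphic_no_max alphaE (@omega_mul_no_max _ nu).
(* The position [a] tells the two constant sequences apart. *)
have [a] : inhabited alpha.
  have [f [[g _ _] _]] := alphaE; case: nu_ge1 => n.
  exact: inhabits (g (n, 0%N)).
pose bot : order_topology (R01 alpha) := \pi_(R01 alpha) (fun=> false).
pose top : order_topology (R01 alpha) := \pi_(R01 alpha) (fun=> true).
have bot_le u : bot <= u.
  by rewrite -[u](@reprK _ (R01 alpha)); apply/pi_le/binseq_ge0.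
have le_top u : u <= top.
  by rewrite -[u](@reprK _ (R01 alpha)); apply/pi_le/binseq_le1.
have bot_top : bot < top.
  apply/(pi_lt no_max); split; last first.
    (* Beyond a jump at [b] the constant sequence 0 would have to take the value 1. *)
    by move=> [b [_ _ _ tl]]; have [c /tl[]] := no_max b.
  rewrite lt_neqAle binseq_le1 andbT; apply/eqP => /(congr1 (@^~ a)).
  by [].
have connT : connected [set: order_topology (R01 alpha)].
  apply: connected_linear_continuum => [u v|S _ _].
    exact: R01_dense.
  exact: R01_supremum.
split; first exact: finely_covered2 bot_le le_top.
move=> k; exact: finely_covered_ge2 bot_top.
Qed.
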